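(* Let $(M,\omega)$ be a closed connected symplectic manifold with a symplectic action of a torus $G=C\times T^r$, where $C$ is the maximal subtorus on which the action is Hamiltonian and $T^r$ is a complementary $r$-dimensional subtorus (which acts in a totally non-Hamiltonian way). Let $b_1(M)$ denote the first Betti number of $M$. Then $$r\leq b_1(M).$$
   Context: For $\xi$ in the Lie algebra of $G$, $X_\xi$ is the fundamental vector field $X_\xi(x)=\frac{d}{dt}|_{t=0}\exp(-t\xi).x$. A symplectic action is Hamiltonian if the 1-form $i_{X_\xi}\omega$ is exact for every $\xi$ in the Lie algebra (no equivariance is required). A torus acts in a totally non-Hamiltonian way if $i_{X_\eta}\omega$ is non-exact for every nonzero $\eta$ in its Lie algebra. *)

(* Defs.v *)
From HB Require Import structures.
From mathcomp Require Import all_boot all_order all_algebra.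
From mathcomp Require Import all_classical all_reals all_analysis.

Set Implicit Arguments.
Unset Strict Implicit.
Unset Printing Implicit Defensive.

Import Order.TTheory GRing.Theory Num.Theory.
Import numFieldNormedType.Exports.

Local Open Scope classical_set_scope.
Local Open Scope ring_scope.

(* C^k on an open subset U of a finite-dimensional space: differentiable with
   all directional derivatives of class C^(k-1).  The values of f outside U do
   not matter when U is open. *)
Fixpoint Ck_on (R : realType) (V W : normedModType R) (k : nat)
    (U : set V) (f : V -> W) : Prop :=
  match k with
  | 0 => forall x, U x -> {for x, continuous f}
  | k'.+1 => (forall x, U x -> differentiable f x) /\
             forall v : V, Ck_on k' U (fun x => 'D_v f x)
  end.

Definition smooth_on (R : realType) (V W : normedModType R)
    (U : set V) (f : V -> W) : Prop := forall k, Ck_on k U f.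

Record chart (R : realType) (m : nat) (M : topologicalType) := Chart {
  dom : set M ;
  fwd : M -> 'rV[R]_m ;
  bwd : 'rV[R]_m -> M ;
  open_dom : open dom ;
  open_img : open (fwd @` dom) ;
  fwdK : forall p, dom p -> bwd (fwd p) = p ;
  fwd_cont : forall p, dom p -> {for p, continuous fwd} ;
  bwd_cont : forall x, (fwd @` dom) x -> {for x, continuous bwd} }.

Definition img (R : realType) (m : nat) (M : topologicalType)
    (c : chart R m M) : set 'rV[R]_m := fwd c @` dom c.

(* Second countability is not required: it is automatic for the compact
   manifolds to which this is applied.  There is no boundary, since charts take
   values in open subsets of R^m. *)
Record manifold (R : realType) (m : nat) := Manifold {
  carrier :> topologicalType ;
  carrier_hausdorff : hausdorff_space carrier ;
  chart_index : Type ;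
  atlas : chart_index -> chart R m carrier ;
  atlas_cover : forall p : carrier, exists i, dom (atlas i) p ;
  atlas_smooth : forall i j,
    smooth_on (fwd (atlas i) @` (dom (atlas i) `&` dom (atlas j)))
      (fwd (atlas j) \o bwd (atlas i)) }.

Section DifferentialForms.
Variables (R : realType) (m : nat) (M : manifold R m).

(* The expression in the charts i and j of a map g : M -> M. *)
Definition local_map (g : M -> M) (i j : chart_index M) : 'rV[R]_m -> 'rV[R]_m :=
  fwd (atlas j) \o g \o bwd (atlas i).

(* Matrix, in the charts i (at p) and j (at g p), of the tangent map of g at p.
   Tangent vectors are row vectors and the matrix acts on the right. *)
Definition tangent_mx (g : M -> M) (i j : chart_index M) (p : M) : 'M[R]_m :=
  'J (local_map g i j) (fwd (atlas i) p).

Definition partial (W : normedModType R) (a : 'I_m) (f : 'rV[R]_m -> W) :=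
  fun x => 'D_(delta_mx ord0 a) f x.

Definition smooth_fun (f : M -> R) : Prop :=
  forall i, smooth_on (img (atlas i)) (f \o bwd (atlas i) : 'rV[R]_m -> R^o).

(* A differential form is given by its components in each chart i, at each
   point p of the domain of i (the values elsewhere are irrelevant).  A 1-form
   has a column of components: its value on the tangent vector v (a row) is
   v *m alpha i p.  A 2-form has a matrix of components: its value on v, w is
   v *m omega i p *m w^T. *)
Definition components1 := chart_index M -> M -> 'cV[R]_m.
Definition components2 := chart_index M -> M -> 'M[R]_m.

Definition is_form1 (alpha : components1) : Prop :=
  (forall i, smooth_on (img (atlas i)) (alpha i \o bwd (atlas i))) /\
  (forall i j p, dom (atlas i) p -> dom (atlas j) p ->
     alpha i p = tangent_mx id i j p *m alpha j p).

Definition is_form2 (omega : components2) : Prop :=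
  (forall i, smooth_on (img (atlas i)) (omega i \o bwd (atlas i))) /\
  (forall i p, dom (atlas i) p -> forall a b, omega i p a b = - omega i p b a) /\
  (forall i j p, dom (atlas i) p -> dom (atlas j) p ->
     omega i p = tangent_mx id i j p *m omega j p *m (tangent_mx id i j p)^T).

Definition closed_form1 (alpha : components1) : Prop :=
  forall i x, img (atlas i) x -> forall a b : 'I_m,
    let c := alpha i \o bwd (atlas i) in
    partial a c x b ord0 - partial b c x a ord0 = 0.

Definition closed_form2 (omega : components2) : Prop :=
  forall i x, img (atlas i) x -> forall a b c : 'I_m,
    let o := omega i \o bwd (atlas i) in
    partial a o x b c + partial b o x c a + partial c o x a b = 0.

Definition exact_form1 (alpha : components1) : Prop :=
  exists2 f : M -> R, smooth_fun f &
    forall i p, dom (atlas i) p -> forall a,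
      alpha i p a ord0 =
        partial a (f \o bwd (atlas i) : 'rV[R]_m -> R^o) (fwd (atlas i) p).

Definition lin_comb1 (k : nat) (c : 'I_k -> R) (alpha : 'I_k -> components1) :
    components1 := fun i p => \sum_(l < k) c l *: alpha l i p.

(* The classes of the forms alpha l are linearly independent in the first
   de Rham cohomology H^1(M; R) = {closed 1-forms} / {exact 1-forms}. *)
Definition independent_classes (k : nat) (alpha : 'I_k -> components1) : Prop :=
  (forall l, is_form1 (alpha l) /\ closed_form1 (alpha l)) /\
  (forall c : 'I_k -> R, exact_form1 (lin_comb1 c alpha) -> forall l, c l = 0).

(* The first Betti number is the dimension of H^1(M; R), i.e. the largest size
   of a linearly independent family (de Rham).  It is an extended number because
   finite-dimensionality of H^1(M; R) for compact M is not in the library. *)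
Definition betti1 : \bar R :=
  ereal_sup [set (k%:R)%:E | k in
    [set k : nat | exists alpha : 'I_k -> components1,
       independent_classes alpha]].

Record symplectic_form := SymplecticForm {
  sform :> chart_index M -> M -> 'M[R]_m ;
  sform_form : is_form2 sform ;
  sform_closed : closed_form2 sform ;
  sform_nondeg : forall i p, dom (atlas i) p -> sform i p \in unitmx }.

End DifferentialForms.

(* The torus of dimension n is R^n / Z^n, with Lie algebra R^n and exponential
   map the projection R^n -> R^n / Z^n. *)
Definition integer_vec (R : realType) (n : nat) (z : 'rV[R]_n) : Prop :=
  forall j, z ord0 j \is a Num.int.

(* A smooth action of R^n / Z^n, written as a function of representatives in
   R^n: tact t p = exp(t).p.  The projection R^n -> R^n / Z^n being a local
   diffeomorphism, smoothness can be tested on R^n x M. *)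
Record torus_action (R : realType) (m n : nat) (M : manifold R m) := TorusAction {
  tact :> 'rV[R]_n -> M -> M ;
  tactD : forall s t p, tact (s + t) p = tact s (tact t p) ;
  tact_int : forall z p, integer_vec z -> tact z p = p ;
  tact_cont : continuous (fun tp : 'rV[R]_n * M => tact tp.1 tp.2) ;
  tact_smooth : forall i j,
    smooth_on
      [set tx : 'rV[R]_n * 'rV[R]_m | img (atlas i) tx.2 /\
         dom (atlas j) (tact tx.1 (bwd (atlas i) tx.2))]
      (fun tx => fwd (atlas j) (tact tx.1 (bwd (atlas i) tx.2))) }.

Section Actions.
Variables (R : realType) (m n : nat) (M : manifold R m).
Variables (omega : symplectic_form M) (act : torus_action n M).

Definition symplectic_action : Prop :=
  forall (t : 'rV[R]_n) i j p, dom (atlas i) p -> dom (atlas j) (act t p) ->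
    omega i p =
      tangent_mx (act t) i j p *m omega j (act t p) *m
        (tangent_mx (act t) i j p)^T.

(* Components in the chart i of X_xi(p) = d/dt|_(t=0) exp(- t xi).p. *)
Definition fundamental_field (xi : 'rV[R]_n) (i : chart_index M) (p : M) :
    'rV[R]_m :=
  derive1 (fun t : R => fwd (atlas i) (act (- (t *: xi)) p)) 0.

(* The 1-form i_(X_xi) omega = omega(X_xi, -). *)
Definition contraction (xi : 'rV[R]_n) : components1 M :=
  fun i p => (fundamental_field xi i p *m omega i p)^T.

(* Linear subspaces of the Lie algebra are represented as row spaces of square
   matrices.  In a torus, the connected Lie subgroups are the exp(h), for h a
   linear subspace; the preimage of exp(h) in R^n is h + Z^n. *)
Definition in_exp (h : 'M[R]_n) : set 'rV[R]_n :=
  [set v | exists2 z : 'rV[R]_n, integer_vec z & (v - z <= h)%MS].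

(* exp(h) is a subtorus, i.e. a closed connected subgroup. *)
Definition subtorus (h : 'M[R]_n) : Prop := closed (in_exp h).

(* exp(c) and exp(h) are complementary: the torus is their internal direct
   product. *)
Definition complementary (c h : 'M[R]_n) : Prop :=
  (forall v, exists s t, [/\ in_exp c s, in_exp h t & v = s + t]) /\
  (forall v, in_exp c v -> in_exp h v -> integer_vec v).

Definition hamiltonian_on (h : 'M[R]_n) : Prop :=
  forall xi : 'rV[R]_n, (xi <= h)%MS -> exact_form1 (contraction xi).

Definition totally_non_hamiltonian_on (h : 'M[R]_n) : Prop :=
  forall eta : 'rV[R]_n, (eta <= h)%MS -> eta != 0 ->
    ~ exact_form1 (contraction eta).

Definition maximal_hamiltonian_subtorus (c : 'M[R]_n) : Prop :=
  [/\ subtorus c, hamiltonian_on c &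
    forall c' : 'M[R]_n, subtorus c' -> hamiltonian_on c' ->
      (c <= c')%MS -> (c' <= c)%MS].

End Actions.

(* Main.v *)
Require Import Defs.
From HB Require Import structures.
From mathcomp Require Import all_boot all_order all_algebra.
From mathcomp Require Import all_classical all_reals all_analysis.
From mathcomp Require Import ring lra.
Import numFieldNormedType.Exports.
Local Open Scope classical_set_scope.
Local Open Scope ring_scope.

Set Implicit Arguments.
Unset Strict Implicit.
Unset Printing Implicit Defensive.

Import Order.TTheory GRing.Theory Num.Theory.

(** The bound comes from explicit cohomology classes: if eta_1, ..., eta_r is a
    basis of the Lie algebra of T, the 1-forms i_(X_(eta_l)) omega are closed,
    and no nontrivial linear combination of them is exact.

    Independence is linear algebra.  The form i_(X_xi) omega depends linearly
    on xi, because X_xi is a directional derivative of the differentiable map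
    (t, x) |-> exp(t).x ([contraction_linear]).  A combination of the forms
    with coefficients c is thus the contraction by eta = sum_l c_l eta_l; if it
    is exact, total non-Hamiltonicity forces eta = 0, hence c = 0.

    Closedness is Cartan's formula L_X omega = d i_X omega + i_X d omega, in
    which L_X omega = 0 by invariance and d omega = 0.  It is proved in one
    chart, where omega is a matrix-valued function w, X a row-valued function,
    and the tangent map of the flow a Jacobian matrix A(s).  Differentiating
    the invariance w(x) = A(s) w(phi_s(x)) A(s)^T at s = 0 gives
    dX w + D_X w + w dX^T = 0 ([lie_derivative0]), which together with the
    antisymmetry of w and with d omega = 0 is d i_X omega = 0
    ([cartan_formula]).  The derivative of A(s) at 0 is the Jacobian dX of the
    field since time and space derivatives of the flow commute: this is the
    symmetry of second derivatives ([derive_sym]), which is derived here from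
    the mean value theorem. *)

(** * Symmetry of second derivatives *)

Section Calculus.
Variable R : realType.
Implicit Types V W : normedModType R.

Lemma near_eq_differentiable V W (f g : V -> W) x :
  {near x, f =1 g} -> differentiable f x -> differentiable g x.
Proof.
move=> fg df.
have [dfc dfo] := (diff_locallyP x f).1 df.
have e : g \o shift x = cst (g x) + 'd f x +o_ 0 id.
  apply/eqaddoP => e e0.
  have /eqaddoP/(_ e e0) fo := dfo.
  have fg0 : \forall h \near 0, f (h + x) = g (h + x).
    by move: fg; rewrite (near_shift 0 x) subr0.
  near=> h.
  have fgh : f (h + x) = g (h + x) by near: h; exact: fg0.
  have fgx : f x = g x := nbhs_singleton fg.
  suff -> : (g \o shift x - (cst (g x) + 'd f x)) h =
            (f \o shift x - (cst (f x) + 'd f x)) h by near: h.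
  by rewrite !fctE /= fgh fgx.
by apply/diff_locallyP; rewrite (diff_unique dfc e).
Unshelve. all: by end_near. Qed.

(** Directional derivatives only see the restriction of f to a line, so a
    reparametrization g that follows that line need not be differentiable; this
    applies to slices y |-> (a, y) and to one-parameter subgroups. *)
Lemma derive_reparam V V' W (f : V -> W) (g : V' -> V) (x v : V') (w : V) :
  (forall h : R, g (h *: v + x) = h *: w + g x) ->
  'D_v (f \o g) x = 'D_w f (g x).
Proof.
move=> gE; rewrite /derive.
by under eq_fun do rewrite /= gE.
Qed.

Lemma derivable_reparam V V' W (f : V -> W) (g : V' -> V) (x v : V') (w : V) :
  (forall h : R, g (h *: v + x) = h *: w + g x) ->
  derivable f (g x) w -> derivable (f \o g) x v.
Proof.
move=> gE; rewrite /derivable.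
by under [in X in _ -> X]eq_fun do rewrite /= gE.
Qed.

(** The second difference of f along h u and h v is, by the mean value theorem
    applied to g(t) = f(x + t u + h v) - f(x + t u), equal to h times an increment
    of D_u f; differentiability of D_u f at the single point x then compares it
    with h^2 D_v D_u f(x).  The second difference itself is symmetric in u and v. *)
Lemma second_difference V (f : V -> R) (x u v : V) (e : R) : 0 < e ->
  {near x, forall z, differentiable f z} ->
  differentiable (fun z => 'D_u f z) x ->
  \forall h \near 0^'+,
    `|f (x + h *: u + h *: v) - f (x + h *: u) - f (x + h *: v) + f x
      - h ^+ 2 * 'D_v (fun z => 'D_u f z) x| <= e * h ^+ 2.
Proof.
move=> e0 df dDf; pose phi z := 'D_u f z.
(* 2|u| + |v| bounds the two first-order errors below, relative to h; the
   summand 1 makes K invertible when u = v = 0. *)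
pose K := 2 * `|u| + `|v| + 1.
have K0 : 0 < K by rewrite ltr_wpDl// addr_ge0// mulr_ge0.
have /diff_locallyP[_ /eqaddoP/(_ (e / K)) phio] := dDf.
have eK0 : 0 < e / K by rewrite divr_gt0.
have {}phio := phio eK0.
have dfk : \forall k \near (0 : V), differentiable f (k + x).
  by move: df; rewrite (near_shift 0 x) subr0.
have /nbhs_ballP[d /= d0 Hd] : \forall k \near (0 : V), differentiable f (k + x) /\
   `|phi (k + x) - (phi x + 'd phi x k)| <= e / K * `|k|.
  near=> k; split; [by near: k | by near: k; exact: phio].
have small (t s h : R) : 0 <= t <= h -> 0 <= s <= h -> h < d / K ->
    ball (0 : V) d (t *: u + s *: v).
  move=> /andP[t0 th] /andP[s0 sh] hd.
  rewrite -ball_normE /= sub0r normrN (le_lt_trans (ler_normD _ _))//.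
  rewrite !normrZ !ger0_norm//.
  have h0 : 0 <= h := le_trans t0 th.
  apply: (@le_lt_trans _ _ (h * K)); last by rewrite -ltr_pdivlMr.
  rewrite /K !mulrDr mulr1 -addrA lerD//.
    by rewrite mulrA ler_wpM2r// (le_trans th)// ler_peMr// ler1n.
  by rewrite ler_wpDr// ler_wpM2r.
near=> h.
have h0 : 0 < h by [].
have hd : h < d / K by near: h; apply: nbhs_right_lt; rewrite divr_gt0.
pose g (t : R) := f (x + t *: u + h *: v) - f (x + t *: u).
have gD (t : R) : 0 <= t <= h ->
    is_derive t 1 g (phi (x + t *: u + h *: v) - phi (x + t *: u)).
  move=> th.
  have aux (s : R) : 0 <= s <= h ->
      is_derive t 1 (fun t : R => f (x + t *: u + s *: v)) (phi (x + t *: u + s *: v)).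
    move=> sh; have dfz : differentiable f (x + t *: u + s *: v).
      have [] := Hd _ (small t s h th sh hd).
      by rewrite [_ + _ + x]addrC addrA.
    have aff (k : R) : x + (k *: 1 + t) *: u + s *: v = k *: u + (x + t *: u + s *: v).
      rewrite scalerDl [k *: 1]mulr1 addrCA -!addrA; congr (_ + _).
    apply: DeriveDef.
      apply: (@derivable_reparam _ _ _ f (fun t : R => x + t *: u + s *: v) _ _ u aff).
      exact: diff_derivable.
    exact: (@derive_reparam _ _ _ f (fun t : R => x + t *: u + s *: v) _ _ u aff).
  (* both terms of g have the form treated by aux, with s = h and s = 0 *)
  have -> : g = (fun t : R => f (x + t *: u + h *: v)) -
                (fun t : R => f (x + t *: u + 0 *: v)).
    by apply/funext => s; rewrite /g !fctE scale0r addr0.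
  rewrite -[phi (x + t *: u)]/(phi _) -[X in _ - phi X]addr0 -(scale0r v).
  by apply: is_deriveB; apply: aux; rewrite ?lexx ?(ltW h0).
have [c ch gc] : exists2 c, c \in `[0, h]%R &
    g h - g 0 = (phi (x + c *: u + h *: v) - phi (x + c *: u)) * (h - 0).
  apply: (@MVT_segment R g (fun t => phi (x + t *: u + h *: v) - phi (x + t *: u))).
  - exact: ltW.
  - move=> t; rewrite in_itv /= => /andP[t0 th]; apply: gD.
    by rewrite !ltW.
  - apply: derivable_within_continuous => t; rewrite in_itv /= => th.
    by have [] := gD t th.
have ch' : 0 <= c <= h by move: ch; rewrite in_itv.
have hh : 0 <= h <= h by rewrite lexx ltW.
have z0h : 0 <= (0 : R) <= h by rewrite lexx ltW.
have -> : f (x + h *: u + h *: v) - f (x + h *: u) - f (x + h *: v) + f x = g h - g 0.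
  by rewrite /g scale0r addr0; ring.
have [_ H1] := Hd _ (small c h h ch' hh hd).
have [_ ] := Hd _ (small c 0 h ch' z0h hd).
rewrite scale0r addr0 => H2.
rewrite gc subr0 -/phi deriveE//.
have dE : 'd phi x v * h = ('d phi x (c *: u + h *: v) - 'd phi x (c *: u)).
  by rewrite linearD [_ (c *: u) + _]addrC addrK linearZ /= mulrC.
rewrite expr2 -mulrA [h * 'd phi x v]mulrC dE [h * (_ - _)]mulrC -mulrBl.
rewrite normrM (gtr0_norm h0).
rewrite [e * _]mulrA ler_wpM2r ?(ltW h0)//.
have -> : phi (x + c *: u + h *: v) - phi (x + c *: u) -
    ('d phi x (c *: u + h *: v) - 'd phi x (c *: u)) =
    (phi (c *: u + h *: v + x) - (phi x + 'd phi x (c *: u + h *: v))) -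
    (phi (c *: u + x) - (phi x + 'd phi x (c *: u))).
  by rewrite [_ + x]addrC [_ + x in RHS]addrC addrA; ring.
rewrite (le_trans (ler_normB _ _))//.
apply: le_trans (lerD H1 H2) _.
rewrite -mulrDr -mulrA ler_pM2l// mulrC ler_pdivrMr//.
have/andP[c0 ch0] := ch'.
apply: (@le_trans _ _ ((c * `|u| + h * `|v|) + c * `|u|)).
  rewrite lerD// ?normrZ ?(ger0_norm c0)//.
  by rewrite (le_trans (ler_normD _ _))// !normrZ (ger0_norm c0) (gtr0_norm h0).
have : c * `|u| <= h * `|u| by rewrite ler_wpM2r.
rewrite /K; move: h0; move: (`|u|) (`|v|) => a b h0 H; nra.
Unshelve. all: by end_near. Qed.

(** Both mixed derivatives are the limit, as h tends to 0, of the same second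
    difference divided by h^2 (Young's form of the theorem, with hypotheses at the
    single point x on the first derivatives). *)
Theorem derive_sym V (f : V -> R) (x u v : V) :
  {near x, forall z, differentiable f z} ->
  differentiable (fun z => 'D_u f z) x ->
  differentiable (fun z => 'D_v f z) x ->
  'D_v (fun z => 'D_u f z) x = 'D_u (fun z => 'D_v f z) x.
Proof.
move=> df du dv; apply/eqP; rewrite -subr_eq0 -normr_le0.
apply/ler_addgt0Pl => e e0; rewrite addr0.
have e2 : 0 < e / 2 by rewrite divr_gt0.
have tri (a b c d p q k : R) : `|a - b - c + d - k * p| <= e / 2 * k ->
    `|a - c - b + d - k * q| <= e / 2 * k -> `|(p - q) * k| <= e * k.
  rewrite !ler_norml => /andP[? ?] /andP[? ?]; apply/andP; split; lra.
have H1 := second_difference v e2 df du.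
have H2 := second_difference u e2 df dv.
have [h [[A1 A2] h0]] := filter_ex (filterI (filterI H1 H2) (nbhs_right_gt (0 : R))).
have h2 : 0 < h ^+ 2 by rewrite exprn_gt0.
rewrite -(ler_pM2r h2) -[X in _ * X <= _](gtr0_norm h2) -normrM.
rewrite (addrAC x) in A2.
exact: tri A1 A2.
Qed.
End Calculus.

(** * Smooth matrix-valued functions *)

Section MatrixCalculus.
Variable R : realType.
Implicit Types V W : normedModType R.

Lemma differentiable_mxP V m n (f : V -> 'M[R]_(m, n)) x :
  differentiable f x <-> forall i j, differentiable (fun y => f y i j) x.
Proof.
split=> [df i j|df].
  exact: (differentiable_comp df (differentiable_coord _ _ _)).
have -> : f = \sum_(i < m) \sum_(j < n) (fun y => f y i j *: delta_mx i j).
  apply/funext => y; rewrite [LHS]matrix_sum_delta fct_sumE.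
  by apply: eq_bigr => i _; rewrite fct_sumE.
apply: differentiable_sum => i; apply: differentiable_sum => j.
exact: differentiableZl.
Qed.

Lemma derive_mxE V m n (f : V -> 'M[R]_(m, n)) x v i j :
  derivable f x v -> 'D_v f x i j = 'D_v (fun y => f y i j) x.
Proof. by move=> /derive_mx ->; rewrite mxE. Qed.

Lemma is_derive_mxP V m n (f : V -> 'M[R]_(m, n)) x v (df : 'M[R]_(m, n)) :
  (forall i j, is_derive x v (fun y => f y i j) (df i j)) -> is_derive x v f df.
Proof.
move=> H; have fd : derivable f x v by apply/derivable_mxP => i j; have [] := H i j.
apply: DeriveDef => //; rewrite derive_mx//.
by apply/matrixP => i j; rewrite mxE; have [] := H i j.
Qed.

Lemma is_derive_mulmx V m n p (A : V -> 'M[R]_(m, n)) (B : V -> 'M[R]_(n, p))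
    x v dA dB :
  is_derive x v A dA -> is_derive x v B dB ->
  is_derive x v (fun y => A y *m B y) (dA *m B x + A x *m dB).
Proof.
move=> [Ad <-] [Bd <-]; apply: is_derive_mxP => i j.
have -> : (fun y => (A y *m B y) i j) = \sum_(k < n) (fun y => A y i k) * (fun y => B y k j).
  by apply/funext => y; rewrite mxE fct_sumE.
apply: (is_derive_eq (is_derive_sum (dh := fun k => A x i k *: 'D_v (fun y => B y k j) x +
  B x k j *: 'D_v (fun y => A y i k) x) _)).
  move=> k; apply: is_deriveM; apply: derivableP; exact: (derivable_mxP _ _ _).1.
rewrite !mxE -big_split; apply: eq_bigr => k _ /=.
rewrite addrC !derive_mxE //; congr (_ + _); exact: mulrC.
Qed.

Lemma is_derive_trmx V k l (A : V -> 'M[R]_(k, l)) (x v : V) dA :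
  is_derive x v A dA -> is_derive x v (fun y => (A y)^T) dA^T.
Proof.
move=> [Ad <-]; apply: is_derive_mxP => a b; rewrite mxE derive_mxE//.
under eq_fun do rewrite mxE.
by apply: derivableP; exact: (derivable_mxP _ _ _).1.
Qed.

Lemma Ck_onW V W k (U : set V) (f : V -> W) : Ck_on k.+1 U f -> Ck_on k U f.
Proof.
elim: k f => [|k IH] f [df Df]; first by move=> x /df /differentiable_continuous.
by split=> // v; apply: IH; exact: Df.
Qed.

(** Openness of U matters: derivatives at a point of U are determined by the
    values of the function on a neighbourhood of that point. *)
Lemma Ck_on_eq V W k (U : set V) (f g : V -> W) : open U ->
  (forall x, U x -> f x = g x) -> Ck_on k U f -> Ck_on k U g.
Proof.
move=> oU; elim: k f g => [|k IH] f g fg.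
  move=> Cf x Ux; suff: g y @[y --> x] --> g x by [].
  rewrite -(fg x Ux).
  apply: cvg_trans (Cf x Ux); apply: near_eq_cvg.
  by near=> y; apply: fg; near: y; exact: open_nbhs_nbhs.
have fgn x : U x -> {near x, f =1 g}.
  by move=> Ux; near=> y; apply: fg; near: y; exact: open_nbhs_nbhs.
move=> [df Df]; split=> [x Ux|v].
  exact: near_eq_differentiable (fgn x Ux) (df x Ux).
by apply: IH (Df v) => x Ux; apply: near_eq_derive; exact: fgn.
Unshelve. all: by end_near. Qed.

Lemma Ck_onS V W k (U U' : set V) (f : V -> W) : U `<=` U' -> Ck_on k U' f -> Ck_on k U f.
Proof.
move=> UU'; elim: k f => [|k IH] f; first by move=> Cf x /UU' /Cf.
by move=> [df Df]; split=> [x /UU'|v]; [exact: df|exact/IH/Df].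
Qed.

Lemma Ck_on_mxP V m n k (U : set V) (f : V -> 'M[R]_(m, n)) : open U ->
  Ck_on k U f <-> forall i j, Ck_on k U (fun x => f x i j).
Proof.
move=> oU; elim: k f => [|k IH] f.
  split=> [Cf i j x Ux|Cf x Ux].
    apply: (@continuous_comp _ _ _ f (fun M : 'M[R]_(m, n) => M i j)).
      exact: Cf.
    exact: coord_continuous.
  have -> : f = \sum_(i < m) \sum_(j < n) (fun y => f y i j *: delta_mx i j).
    apply/funext => y; rewrite [LHS]matrix_sum_delta fct_sumE.
    by apply: eq_bigr => i _; rewrite fct_sumE.
  have cont0 : {for x, continuous (0 : V -> 'M[R]_(m, n))} by exact: cvg_cst.
  have contD (g h : V -> 'M[R]_(m, n)) : {for x, continuous g} ->
      {for x, continuous h} -> {for x, continuous (g + h)} by exact: cvgD.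
  apply: big_ind => // i _; apply: big_ind => // j _.
  by apply: cvgZr_tmp; exact: Cf.
have Df v i j x : differentiable f x -> 'D_v f x i j = 'D_v (fun y => f y i j) x.
  by move=> df; apply: derive_mxE; exact: diff_derivable.
split=> [[df Cf] i j|Cf].
  split=> [x Ux|v]; first by move: (df x Ux) => /differentiable_mxP.
  apply: (@Ck_on_eq _ _ _ _ (fun x => 'D_v f x i j)) => //.
    by move=> x Ux; apply: Df; exact: df.
  exact: ((IH _).1 (Cf v)).
have df x : U x -> differentiable f x.
  by move=> Ux; apply/differentiable_mxP => i j; exact: (Cf i j).1.
split=> // v; apply/IH => i j.
apply: (@Ck_on_eq _ _ _ _ ('D_v (fun y => f y i j))) => //.
  by move=> x Ux; rewrite Df//; exact: df.
exact: (Cf i j).2.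
Qed.

Lemma Ck_onD V W k (U : set V) (f g : V -> W) : open U ->
  Ck_on k U f -> Ck_on k U g -> Ck_on k U (f + g).
Proof.
move=> oU; elim: k f g => [|k IH] f g;
  first by move=> Cf Cg x Ux; exact: (cvgD (Cf x Ux) (Cg x Ux)).
move=> [df Df] [dg Dg]; split=> [x Ux|v].
  by apply: differentiableD; [exact: df|exact: dg].
apply: (@Ck_on_eq _ _ _ _ ('D_v f + 'D_v g)) => //; last by apply: IH; [exact: Df|exact: Dg].
by move=> x Ux; rewrite deriveD//; apply: diff_derivable; [exact: df|exact: dg].
Qed.

Lemma Ck_onM V k (U : set V) (f g : V -> R) : open U ->
  Ck_on k U f -> Ck_on k U g -> Ck_on k U (f * g).
Proof.
move=> oU; elim: k f g => [|k IH] f g;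
  first by move=> Cf Cg x Ux; exact: (cvgM (Cf x Ux) (Cg x Ux)).
move=> Cf Cg; have [df Df] := Cf; have [dg Dg] := Cg; split=> [x Ux|v].
  by apply: differentiableM; [exact: df|exact: dg].
apply: (@Ck_on_eq _ _ _ _ (f * 'D_v g + g * 'D_v f)) => //.
  by move=> x Ux; rewrite deriveM//; apply: diff_derivable; [exact: df|exact: dg].
by apply: Ck_onD => //; apply: IH; first [exact: Ck_onW|exact: Dg|exact: Df].
Qed.

Lemma Ck_on_cst V W k (U : set V) (a : W) : Ck_on k U (cst a).
Proof.
elim: k a => [|k IH] a; first by move=> x _; exact: cvg_cst.
split=> [x _|v]; first exact: differentiable_cst.
by rewrite (_ : 'D_v (cst a) = cst 0) //; apply/funext => x; rewrite derive_cst.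
Qed.

Lemma Ck_on_sum V W k (U : set V) n (f : 'I_n -> V -> W) : open U ->
  (forall i, Ck_on k U (f i)) -> Ck_on k U (\sum_(i < n) f i).
Proof.
move=> oU Cf; elim/big_ind : _ => // [|g h]; [exact: Ck_on_cst|exact: Ck_onD].
Qed.

Lemma smooth_on_mulmx V m n p (U : set V) (A : V -> 'M[R]_(m, n))
    (B : V -> 'M[R]_(n, p)) : open U ->
  smooth_on U A -> smooth_on U B -> smooth_on U (fun x => A x *m B x).
Proof.
move=> oU CA CB k; apply/Ck_on_mxP => // i j.
have -> : (fun y => (A y *m B y) i j) = \sum_(k < n) (fun y => A y i k) * (fun y => B y k j).
  by apply/funext => y; rewrite mxE fct_sumE.
apply: Ck_on_sum => // l; apply: Ck_onM => //.
  exact: ((Ck_on_mxP _ _ oU).1 (CA k)).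
exact: ((Ck_on_mxP _ _ oU).1 (CB k)).
Qed.

Lemma smooth_on_trmx V m n (U : set V) (A : V -> 'M[R]_(m, n)) : open U ->
  smooth_on U A -> smooth_on U (fun x => (A x)^T).
Proof.
move=> oU CA k; apply/Ck_on_mxP => // i j.
under eq_fun do rewrite mxE.
exact: ((Ck_on_mxP _ _ oU).1 (CA k)).
Qed.

Lemma smooth_on_derive V W (U : set V) (f : V -> W) v :
  smooth_on U f -> smooth_on U ('D_v f).
Proof. by move=> Cf k; exact: (Cf k.+1).2. Qed.

Lemma smooth_on_differentiable V W (U : set V) (f : V -> W) x :
  smooth_on U f -> U x -> differentiable f x.
Proof. by move=> Cf Ux; exact: (Cf 1%N).1. Qed.

Lemma derive_slice V1 V2 W (f : V1 * V2 -> W) a y v :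
  'D_v (fun z => f (a, z)) y = 'D_((0, v) : V1 * V2) f (a, y).
Proof.
apply: (@derive_reparam _ _ _ _ f (fun z => (a, z)) y v (0, v)) => h.
by congr pair; rewrite /= scaler0 add0r.
Qed.

Lemma differentiable_slice V1 V2 W (f : V1 * V2 -> W) a y :
  differentiable f (a, y) -> differentiable (fun z => f (a, z)) y.
Proof. by move=> df; apply: (@differentiable_comp _ _ _ _ (fun z => (a, z)) f). Qed.

Lemma smooth_on_slice V1 V2 W (U : set (V1 * V2)) (f : V1 * V2 -> W) a :
  smooth_on U f -> smooth_on [set y | U (a, y)] (fun y => f (a, y)).
Proof.
move=> Cf k; elim: k f {Cf}(Cf k) => [|k IH] f.
  move=> Cf y Uy; apply: (@continuous_comp _ _ _ (fun z => (a, z)) f); last exact: Cf.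
  by apply: cvg_pair; [exact: cvg_cst|exact: cvg_id].
move=> [df Df]; split=> [y Uy|v].
  by apply: differentiable_slice; exact: df.
rewrite (_ : 'D_v _ = fun y => 'D_((0, v) : V1 * V2) f (a, y)).
  exact: (IH _ (Df _)).
by apply/funext => y; rewrite derive_slice.
Qed.

Lemma derive_comp V1 V W (f : V1 -> V) (g : V -> W) x v :
  differentiable f x -> differentiable g (f x) ->
  'D_v (g \o f) x = 'D_('D_v f x) g (f x).
Proof.
move=> df dg; have dgf := differentiable_comp df dg.
by rewrite !deriveE// diff_comp.
Qed.

Lemma derive_linear V W (f : V -> W) x (I : finType) (c : I -> R) (v : I -> V) :
  differentiable f x ->
  'D_(\sum_i c i *: v i) f x = \sum_i c i *: 'D_(v i) f x.
Proof.
move=> df; rewrite deriveE// linear_sum; apply: eq_bigr => i _.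
by rewrite linearZ /= deriveE.
Qed.

Lemma row_jacobian m n (f : 'rV[R]_m -> 'rV[R]_n) x a :
  differentiable f x -> row a ('J f x) = 'D_(delta_mx ord0 a) f x.
Proof. by move=> df; rewrite rowE -deriveEjacobian. Qed.

(** Reduces to [derive_sym] entry by entry, since the mean value theorem is
    about real-valued functions. *)
Lemma derive_sym_smooth V m n (U : set V) (f : V -> 'M[R]_(m, n)) x u v :
  open U -> smooth_on U f -> U x ->
  'D_v ('D_u f) x = 'D_u ('D_v f) x.
Proof.
move=> oU Cf Ux; have Un : {near x, forall z, U z} by exact: open_nbhs_nbhs.
have entry w w' i j : 'D_w ('D_w' f) x i j = 'D_w ('D_w' (fun z => f z i j)) x.
  rewrite derive_mxE; last first.
    exact/diff_derivable/(smooth_on_differentiable (smooth_on_derive _ Cf) Ux).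
  apply: near_eq_derive; near=> z; rewrite derive_mxE//.
  apply/diff_derivable/(smooth_on_differentiable Cf); near: z; exact: Un.
have Ce i j : smooth_on U (fun z => f z i j).
  by move=> k; exact: ((Ck_on_mxP _ _ oU).1 (Cf k)).
apply/matrixP => i j.
refine (etrans (entry v u i j) (etrans _ (esym (entry u v i j)))).
apply: (@derive_sym _ _ (fun z => f z i j)).
- near=> z; apply: (smooth_on_differentiable (Ce i j)); near: z; exact: Un.
- exact: smooth_on_differentiable (smooth_on_derive _ (Ce i j)) Ux.
- exact: smooth_on_differentiable (smooth_on_derive _ (Ce i j)) Ux.
Unshelve. all: by end_near. Qed.

End MatrixCalculus.

(** * Cartan's formula at a point *)

(** [J], [Dw k] and [w] stand for the Jacobian of the field, the k-th partial
    derivative of the 2-form and the 2-form itself.  The hypotheses are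
    antisymmetry of w and of its derivatives, d omega = 0 and L_X omega = 0; the
    conclusion is the (a, b) component of d i_X omega = 0. *)
Lemma cartan_formula (R : comPzRingType) m (X : 'rV[R]_m) (w : 'M[R]_m)
    (Dw : 'I_m -> 'M[R]_m) (J : 'M[R]_m) a b :
  (forall c d, w c d = - w d c) ->
  (forall c d e, Dw c d e = - Dw c e d) ->
  (forall c d e, Dw c d e + Dw d e c + Dw e c d = 0) ->
  J *m w + \sum_k X ord0 k *: Dw k + w *m J^T = 0 ->
  (J *m w) a b + (X *m Dw a) ord0 b - ((J *m w) b a + (X *m Dw b) ord0 a) = 0.
Proof.
move=> wA DA cl /(congr1 (fun A : 'M[R]_m => A a b)).
rewrite 2!mxE summxE [in X in _ = X -> _]mxE => lie.
have DwE : \sum_k (X ord0 k *: Dw k) a b =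
    (X *m Dw a) ord0 b - (X *m Dw b) ord0 a.
  rewrite !mxE -sumrB; apply: eq_bigr => k _; rewrite mxE -mulrBr; congr (_ * _).
  by rewrite -[LHS]subr0 -(cl a b k) (DA a b k); ring.
have JwE : (J *m w) b a = - (w *m J^T) a b.
  rewrite !mxE -sumrN; apply: eq_bigr => k _.
  by rewrite mxE (wA a k) mulNr opprK mulrC.
by rewrite -[RHS]lie DwE JwE; ring.
Qed.

(** * The action in charts and the contracted form *)

Section TorusAction.
Variables (R : realType) (m n : nat) (M : manifold R m).
Variables (omega : symplectic_form M) (act : torus_action n M).
Implicit Types (i j : chart_index M) (p : M) (xi : 'rV[R]_n) (x : 'rV[R]_m).

(** The action read in a source chart i and a target chart j.  The group
    variable is kept as an argument, so that a single smooth function accounts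
    for the field, for the Jacobians of the flow and for their mixed
    derivatives. *)
Definition flow (i j : chart_index M) (tx : 'rV[R]_n * 'rV[R]_m) : 'rV[R]_m :=
  fwd (atlas j) (act tx.1 (bwd (atlas i) tx.2)).

Definition flow_dom (i j : chart_index M) : set ('rV[R]_n * 'rV[R]_m) :=
  [set tx | img (atlas i) tx.2 /\ dom (atlas j) (act tx.1 (bwd (atlas i) tx.2))].

Lemma smooth_flow i j : smooth_on (flow_dom i j) (flow i j).
Proof. exact: tact_smooth. Qed.

Lemma open_flow_dom i j : open (flow_dom i j).
Proof.
rewrite openE => -[t x] [/= Ux Dx].
have imgx : \forall z \near ((t, x) : 'rV[R]_n * 'rV[R]_m), img (atlas i) z.2.
  apply: (@cvg_snd _ _ (nbhs t) (nbhs x)).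
  by apply: open_nbhs_nbhs; split=> //; exact: open_img.
have cvgb : {for ((t, x) : 'rV[R]_n * 'rV[R]_m),
    continuous (fun z : 'rV[R]_n * 'rV[R]_m => bwd (atlas i) z.2)}.
  apply: (@continuous_comp _ _ _ (fun z : 'rV[R]_n * 'rV[R]_m => z.2) (bwd (atlas i))).
    exact: cvg_snd.
  exact: bwd_cont.
have cvgact : {for ((t, x) : 'rV[R]_n * 'rV[R]_m),
    continuous (fun z : 'rV[R]_n * 'rV[R]_m => act z.1 (bwd (atlas i) z.2))}.
  apply: (@continuous_comp _ _ _ (fun z : 'rV[R]_n * 'rV[R]_m => (z.1, bwd (atlas i) z.2))
    (fun tp : 'rV[R]_n * M => act tp.1 tp.2)); last exact: tact_cont.
  have cvga : {for ((t, x) : 'rV[R]_n * 'rV[R]_m),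
      continuous (fun z : 'rV[R]_n * 'rV[R]_m => z.1)} by exact: cvg_fst.
  exact: (cvg_pair cvga cvgb).
apply: filterI; first exact: imgx.
have : nbhs (act t (bwd (atlas i) x)) (dom (atlas j)).
  by apply: open_nbhs_nbhs; split=> //; exact: open_dom.
exact: cvgact.
Qed.

Lemma tact0 p : act 0 p = p.
Proof. by apply: tact_int => j; rewrite mxE. Qed.

Lemma flow_dom0 i j p : dom (atlas i) p -> dom (atlas j) p ->
  flow_dom i j (0, fwd (atlas i) p).
Proof. by move=> Di Dj; split; [exists p|rewrite /= fwdK// tact0]. Qed.

Lemma flow_dom0x i x : img (atlas i) x -> flow_dom i i (0, x).
Proof. by move=> [p Dp <-]; exact: flow_dom0. Qed.

Lemma flow0 i x : img (atlas i) x -> flow i i (0, x) = x.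
Proof. by move=> [p Dp <-]; rewrite /flow /= tact0 fwdK. Qed.

Lemma bwd_dom i x : img (atlas i) x -> dom (atlas i) (bwd (atlas i) x).
Proof. by move=> [p Dp <-]; rewrite fwdK. Qed.

Lemma bwdK i x : img (atlas i) x -> fwd (atlas i) (bwd (atlas i) x) = x.
Proof. by move=> [p Dp <-]; rewrite fwdK. Qed.

Lemma flow_differentiable i j z : flow_dom i j z -> differentiable (flow i j) z.
Proof. exact: smooth_on_differentiable (@smooth_flow i j). Qed.

(** The hypothesis of [derive_reparam] for the curve s |-> (- s xi, x), in the form
    in which it arises for a derivative along 1 at 0. *)
Lemma flow_line (xi : 'rV[R]_n) (x : 'rV[R]_m) (h : R) :
  ((- ((h *: (1 : R^o) + 0) *: xi), x) : 'rV[R]_n * 'rV[R]_m) =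
  h *: (- xi, 0) + (- ((0 : R) *: xi), x).
Proof.
by congr pair; rewrite /= ?scaler0 ?add0r// scale0r oppr0 !addr0 [_ *: 1]mulr1 scalerN.
Qed.

(** The source chart i and the chart j in which the field is read are
    independent: comparing j = i with j <> i gives the transformation rule
    [field_chart]. *)
Lemma field_flow xi i j p : dom (atlas i) p ->
  fundamental_field act xi j p =
  'D_((- xi, 0) : 'rV[R]_n * 'rV[R]_m) (flow i j) (0, fwd (atlas i) p).
Proof.
move=> Di; rewrite /fundamental_field derive1E.
have -> : (fun t : R => fwd (atlas j) (act (- (t *: xi)) p)) =
    flow i j \o (fun t : R => (- (t *: xi), fwd (atlas i) p)).
  by apply/funext => t; rewrite /flow /= fwdK.
rewrite (derive_reparam (flow i j) (flow_line xi (fwd (atlas i) p))).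
by rewrite scale0r oppr0.
Qed.

Lemma smooth_field xi i :
  smooth_on (img (atlas i)) (fundamental_field act xi i \o bwd (atlas i)).
Proof.
move=> k; apply: (@Ck_on_eq _ _ _ _ _
  (fun x => 'D_((- xi, 0) : 'rV[R]_n * 'rV[R]_m) (flow i i) (0, x))).
- exact: open_img.
- by move=> x Ux; rewrite /= (field_flow _ _ (bwd_dom Ux)) bwdK.
- apply: (@Ck_onS _ _ _ _ _ [set x | flow_dom i i (0, x)]); first exact: flow_dom0x.
  exact: (smooth_on_slice _ (smooth_on_derive _ (@smooth_flow i i)) k).
Qed.

(** Near the point, the flow into chart j is the flow into chart i followed by the
    change of charts, so this is the chain rule. *)
Lemma field_chart xi i j p : dom (atlas i) p -> dom (atlas j) p ->
  fundamental_field act xi j p = fundamental_field act xi i p *m tangent_mx id i j p.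
Proof.
move=> Di Dj; rewrite !(field_flow _ _ Di) /tangent_mx.
set z := (0, _); set g := local_map id i j.
have zi : flow_dom i i z by exact: flow_dom0.
have f0 : flow i i z = fwd (atlas i) p by apply: flow0; exists p.
have dg : differentiable g (flow i i z).
  by rewrite f0; apply: (smooth_on_differentiable (@atlas_smooth _ _ M i j)); exists p.
have -> : 'D_((- xi, 0) : 'rV[R]_n * 'rV[R]_m) (flow i j) z =
    'D_((- xi, 0) : 'rV[R]_n * 'rV[R]_m) (g \o flow i i) z.
  apply: near_eq_derive; near=> y.
  have [_ yi] : flow_dom i i y.
    by near: y; apply: open_nbhs_nbhs; split=> //; exact: open_flow_dom.
  by rewrite /g /local_map /flow /= fwdK.
rewrite derive_comp//; last exact: flow_differentiable.
rewrite f0 in dg *; exact: deriveEjacobian.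
Unshelve. all: by end_near. Qed.

(** If J is the tangent matrix of the change of charts, then X_j = X_i J and
    omega_i = J omega_j J^T, hence X_i omega_i = X_j omega_j J^T. *)
Lemma contraction_form xi : is_form1 (Defs.contraction omega act xi).
Proof.
have [Com [_ omT]] := sform_form omega; split=> [i|i j p Di Dj].
  apply: (smooth_on_trmx _); first exact: open_img.
  apply: (smooth_on_mulmx (A := fundamental_field act xi i \o bwd (atlas i))).
  - exact: open_img.
  - exact: smooth_field.
  - exact: Com.
rewrite /Defs.contraction (omT i j p Di Dj) (field_chart _ Di Dj).
by rewrite !mulmxA trmx_mul trmxK.
Qed.

(** Away from the domain of the chart the coordinates need not be differentiable
    along the orbits, and the directional derivative need not be linear in xi. *)
Lemma contraction_linear (I : finType) (c : I -> R) (xi : I -> 'rV[R]_n) i p :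
  dom (atlas i) p ->
  Defs.contraction omega act (\sum_l c l *: xi l) i p =
  \sum_l c l *: Defs.contraction omega act (xi l) i p.
Proof.
move=> Di; rewrite /Defs.contraction.
under [RHS]eq_bigr do rewrite -linearZ /=.
rewrite -linear_sum /=; congr trmx; rewrite (field_flow _ _ Di).
have -> : ((- \sum_l c l *: xi l, 0) : 'rV[R]_n * 'rV[R]_m) =
    \sum_l c l *: ((- xi l, 0) : 'rV[R]_n * 'rV[R]_m).
  rewrite -sumrN; elim/big_rec2: _ => // l a b _ <-.
  by congr pair; rewrite /= ?scalerN// scaler0 addr0.
rewrite derive_linear; last exact/flow_differentiable/flow_dom0.
rewrite mulmx_suml; apply: eq_bigr => l _.
by rewrite -scalemxAl (field_flow _ _ Di).
Qed.
End TorusAction.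

(** * Invariance implies closedness *)

Section Closedness.
Variables (R : realType) (m n : nat) (M : manifold R m).
Variables (omega : symplectic_form M) (act : torus_action n M).
Implicit Types (i j : chart_index M) (p : M) (xi : 'rV[R]_n) (x : 'rV[R]_m).

Definition chart_form i x : 'M[R]_m := omega i (bwd (atlas i) x).

Definition chart_field xi i x : 'rV[R]_m := fundamental_field act xi i (bwd (atlas i) x).

Definition field_jacobian xi i x : 'M[R]_m :=
  \matrix_(a, b) 'D_(delta_mx ord0 a) (chart_field xi i) x ord0 b.

Lemma smooth_form i : smooth_on (img (atlas i)) (chart_form i).
Proof. by have [Com _] := sform_form omega; exact: Com. Qed.

Lemma chart_field_flow xi i x : img (atlas i) x ->
  chart_field xi i x = 'D_((- xi, 0) : 'rV[R]_n * 'rV[R]_m) (flow act i i) (0, x).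
Proof. by move=> Ux; rewrite /chart_field (field_flow _ _ _ (bwd_dom Ux)) bwdK. Qed.

Lemma near_img i x : img (atlas i) x -> {near x, forall y, img (atlas i) y}.
Proof. by move=> Ux; apply: open_nbhs_nbhs; split=> //; exact: open_img. Qed.

Lemma derive_slice_flow i x a t :
  'D_(delta_mx ord0 a) (fun y => flow act i i (t, y)) x =
  'D_((0, delta_mx ord0 a) : 'rV[R]_n * 'rV[R]_m) (flow act i i) (t, x).
Proof. exact: derive_slice. Qed.

Lemma tangent_flow i t x a b : flow_dom act i i (t, x) ->
  tangent_mx (act t) i i (bwd (atlas i) x) a b =
  'D_((0, delta_mx ord0 a) : 'rV[R]_n * 'rV[R]_m) (flow act i i) (t, x) ord0 b.
Proof.
move=> D; have [Ux _] := D; rewrite /tangent_mx (bwdK Ux).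
rewrite -derive_slice_flow -row_jacobian; first by rewrite [RHS]mxE.
apply: differentiable_slice; exact: flow_differentiable.
Qed.

Lemma tangent_flow0 i x : img (atlas i) x ->
  tangent_mx (act 0) i i (bwd (atlas i) x) = 1%:M.
Proof.
move=> Ux; apply/matrixP => a b; rewrite (tangent_flow _ _ (flow_dom0x act Ux)).
rewrite -derive_slice_flow.
rewrite (@near_eq_derive _ _ _ _ id); first by rewrite derive_id !mxE eqxx eq_sym.
near=> y; rewrite flow0//; near: y; exact: near_img.
Unshelve. all: by end_near. Qed.

Lemma near_line xi i x : img (atlas i) x ->
  \forall s \near (0 : R), flow_dom act i i (- (s *: xi), x).
Proof.
move=> Ux.
have c : {for (0 : R), continuous (fun s : R => ((- (s *: xi), x) : 'rV[R]_n * 'rV[R]_m))}.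
  have c1 : {for (0 : R), continuous (fun s : R => - (s *: xi))}.
    by apply: cvgN; apply: cvgZr_tmp; exact: cvg_id.
  exact: (cvg_pair c1 (cvg_cst x)).
apply: c; rewrite /= scale0r oppr0.
by apply: open_nbhs_nbhs; split; [exact: open_flow_dom|exact: flow_dom0x].
Qed.

Lemma is_derive_line W (f : 'rV[R]_n * 'rV[R]_m -> W : normedModType R) xi x :
  differentiable f (0, x) ->
  is_derive (0 : R) 1 (fun s : R => f (- (s *: xi), x))
    ('D_((- xi, 0) : 'rV[R]_n * 'rV[R]_m) f (0, x)).
Proof.
move=> df; have z0 : ((0, x) : 'rV[R]_n * 'rV[R]_m) = (- ((0 : R) *: xi), x).
  by rewrite scale0r oppr0.
rewrite z0 in df *; apply: DeriveDef.
  by apply: (derivable_reparam (flow_line xi x)); exact: diff_derivable.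
exact: (derive_reparam f (flow_line xi x)).
Qed.

(** Entries of the tangent matrix are space derivatives of the flow, entries of
    [field_jacobian] are space derivatives of its time derivative: exchanging the
    two derivatives is what makes the lemma true. *)
Lemma is_derive_tangent xi i x : img (atlas i) x ->
  is_derive (0 : R) 1 (fun s : R => tangent_mx (act (- (s *: xi))) i i (bwd (atlas i) x))
    (field_jacobian xi i x).
Proof.
move=> Ux; have D0 := flow_dom0x act Ux.
pose w a : 'rV[R]_n * 'rV[R]_m := (0, delta_mx ord0 a).
have Sw a := smooth_on_derive (w a) (@smooth_flow _ _ _ _ act i i).
pose A (z : 'rV[R]_n * 'rV[R]_m) : 'M[R]_m :=
  \matrix_(a, b) 'D_(w a) (flow act i i) z ord0 b.
apply: (@near_eq_is_derive _ _ _ (fun s : R => A (- (s *: xi), x))).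
  near=> s; apply/matrixP => a b; rewrite mxE tangent_flow//.
  by near: s; exact: near_line.
apply: is_derive_mxP => a b.
have -> : (fun s : R => A (- (s *: xi), x) a b) =
    (fun s : R => (fun z => 'D_(w a) (flow act i i) z ord0 b) (- (s *: xi), x)).
  by apply/funext => s; rewrite mxE.
have dw : differentiable ('D_(w a) (flow act i i)) (0, x).
  exact: smooth_on_differentiable (Sw a) D0.
apply: (is_derive_eq (is_derive_line
  (f := fun z => 'D_(w a) (flow act i i) z ord0 b : R) xi
  ((differentiable_mxP _ _).1 dw ord0 b))).
rewrite mxE -derive_mxE; last exact: diff_derivable.
rewrite (derive_sym_smooth _ _ (@open_flow_dom _ _ _ _ act i i)
  (@smooth_flow _ _ _ _ act i i) D0).
suff -> : 'D_(delta_mx ord0 a) (chart_field xi i) x =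
    'D_(w a) ('D_((- xi, 0) : 'rV[R]_n * 'rV[R]_m) (flow act i i)) (0, x) by [].
refine (etrans _ (derive_slice ('D_((- xi, 0) : 'rV[R]_n * 'rV[R]_m) (flow act i i)) _ _ _)).
apply: near_eq_derive; near=> y; rewrite chart_field_flow//.
by near: y; exact: near_img.
Unshelve. all: by end_near. Qed.

Lemma is_derive_form_flow xi i x : img (atlas i) x ->
  is_derive (0 : R) 1 (fun s : R => chart_form i (flow act i i (- (s *: xi), x)))
    ('D_(chart_field xi i x) (chart_form i) x).
Proof.
move=> Ux; have D0 := flow_dom0x act Ux.
have df := flow_differentiable D0.
have dg : differentiable (chart_form i) (flow act i i (0, x)).
  by rewrite flow0//; exact: smooth_on_differentiable (@smooth_form i) Ux.
have -> : 'D_(chart_field xi i x) (chart_form i) x =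
    'D_((- xi, 0) : 'rV[R]_n * 'rV[R]_m) (chart_form i \o flow act i i) (0, x).
  by rewrite [RHS](derive_comp _ df dg) (flow0 act Ux) (chart_field_flow xi Ux).
apply: (@is_derive_line _ (chart_form i \o flow act i i)).
exact: differentiable_comp.
Qed.

(** Derivative at s = 0 of the constant function
    s |-> A(s) w(phi_s(x)) A(s)^T = w(x), where phi_s is the action of - s xi and
    A(s) its tangent matrix, with A(0) = 1. *)
Lemma lie_derivative0 xi i x : symplectic_action omega act -> img (atlas i) x ->
  field_jacobian xi i x *m chart_form i x
  + 'D_(chart_field xi i x) (chart_form i) x
  + chart_form i x *m (field_jacobian xi i x)^T = 0.
Proof.
move=> sympl Ux.
have dA := is_derive_tangent xi Ux.
have dT := is_derive_trmx dA.
have dF := is_derive_form_flow xi Ux.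
have dAFT := is_derive_mulmx (is_derive_mulmx dA dF) dT.
have cst0 : is_derive (0 : R) 1 (fun s : R =>
    tangent_mx (act (- (s *: xi))) i i (bwd (atlas i) x) *m
    chart_form i (flow act i i (- (s *: xi), x)) *m
    (tangent_mx (act (- (s *: xi))) i i (bwd (atlas i) x))^T) 0.
  apply: (@near_eq_is_derive _ _ _ (cst (chart_form i x))).
  near=> s.
  have [/= _ Ds] : flow_dom act i i (- (s *: xi), x) by near: s; exact: near_line.
  rewrite {1}/chart_form (sympl (- (s *: xi)) i i _ (bwd_dom Ux) Ds).
  by rewrite /chart_form /flow /= fwdK.
have [_ E1] := dAFT; have [_ E2] := cst0.
move: E2; rewrite E1 scale0r oppr0 (tangent_flow0 Ux) flow0//.
by rewrite trmx1 !mulmx1 !mul1mx.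
Unshelve. all: by end_near. Qed.

Lemma contraction_closed xi : symplectic_action omega act ->
  closed_form1 (Defs.contraction omega act xi).
Proof.
move=> sympl i x Ux a b form.
pose w := chart_form i; pose X := chart_field xi i.
pose Dw (c : 'I_m) : 'M[R]_m := 'D_(delta_mx ord0 c) w x.
have dw : differentiable w x by exact: smooth_on_differentiable (@smooth_form i) Ux.
have dX : differentiable X x.
  exact: (smooth_on_differentiable (@smooth_field _ _ _ _ act xi i) Ux).
have wd v : derivable w x v by exact: diff_derivable.
have Xd v : derivable X x v by exact: diff_derivable.
have [_ [form_anti _]] := sform_form omega.
have E c d : partial c form x d ord0 =
    (field_jacobian xi i x *m w x) c d + (X x *m Dw c) ord0 d.
  have [_] := is_derive_trmx (is_derive_mulmx (derivableP (Xd (delta_mx ord0 c)))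
                       (derivableP (wd (delta_mx ord0 c)))).
  rewrite /partial => ->; rewrite !mxE.
  by congr (_ + _); apply: eq_bigr => k _; rewrite ?mxE.
refine (etrans (congr2 (fun u v => u - v) (E a b) (E b a)) _).
apply: (@cartan_formula _ _ (X x) (w x) Dw) => [c d|c d e|c d e|].
- by apply: form_anti; exact: bwd_dom.
- refine (etrans (derive_mxE _ _ (wd _))
    (etrans _ (congr1 -%R (esym (derive_mxE _ _ (wd _)))))).
  rewrite -deriveN; last exact: (derivable_mxP _ _ _).1.
  apply: near_eq_derive; near=> y; apply: form_anti; apply: bwd_dom.
  by near: y; exact: near_img.
- exact: (sform_closed omega Ux).
- have DX : 'D_(X x) w x = \sum_k X x ord0 k *: Dw k.
    by rewrite {1}[X x]row_sum_delta; exact: derive_linear.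
  by rewrite -DX; exact: lie_derivative0.
Unshelve. all: by end_near. Qed.
End Closedness.

(** * Independence *)

(** Total non-Hamiltonicity turns linear independence in the Lie algebra into
    linear independence in cohomology: an exact combination of the contractions by
    the rows of B is the contraction by an element of h, which must vanish. *)
Lemma contraction_independent (R : realType) (m n k : nat) (M : manifold R m)
    (omega : symplectic_form M) (act : torus_action n M) (h : 'M[R]_n)
    (B : 'M[R]_(k, n)) :
  symplectic_action omega act -> totally_non_hamiltonian_on omega act h ->
  (B <= h)%MS -> row_free B ->
  independent_classes (fun l => Defs.contraction omega act (row l B)).
Proof.
move=> sympl nonham Bh freeB; split=> [l|c [f smf fE]].
  by split; [exact: contraction_form|exact: contraction_closed].
pose eta := (\row_l c l) *m B.
have etaE : eta = \sum_l c l *: row l B.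
  by rewrite /eta mulmx_sum_row; apply: eq_bigr => l _; rewrite mxE.
have eta0 : eta = 0.
  apply: contrapT => /eqP eta_neq0; apply: (nonham eta) => //.
    exact: submx_trans (submxMl _ _) Bh.
  exists f => // i p Di a; rewrite etaE contraction_linear//; exact: fE.
have c0 : \row_l c l = 0 by apply/eqP; rewrite -(mulmx_free_eq0 _ freeB) -/eta eta0.
by move=> l; move/rowP/(_ l): c0; rewrite !mxE.
Qed.

Theorem corollary0p1 (R : realType) (m n r : nat) (M : manifold R m)
    (omega : symplectic_form M) (act : torus_action n M)
    (C T : 'M[R]_n)
    (M_compact : compact [set: M])
    (M_connected : connected [set: M])
    (act_symplectic : symplectic_action omega act)
    (C_maximal : maximal_hamiltonian_subtorus omega act C)
    (T_subtorus : subtorus T)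
    (T_dim : \rank T = r)
    (T_complementary : complementary C T)
    (T_totally_non_hamiltonian : totally_non_hamiltonian_on omega act T) :
  ((r%:R)%:E <= betti1 M)%E.
Proof.
apply: ereal_sup_ubound; exists r => //=; rewrite -T_dim.
exists (fun l => Defs.contraction omega act (row l (row_base T))).
apply: (contraction_independent act_symplectic T_totally_non_hamiltonian).
  by rewrite eq_row_base.
exact: row_base_free.
Qed.
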